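(* For $\lambda,\mu\in\mathbb C$ and $k\in\mathbb N$, $$b^{(k)}_{\lambda,\mu}(\xi,\zeta)=q_k^{\lambda-1,\mu-1}(i\xi,i\zeta)=i^k\,q_k^{\lambda-1,\mu-1}(\xi,\zeta).$$
   Context: For $\lambda,\mu\in\mathbb C$ let $F_{\lambda,\mu}$ be the differential operator on $\mathbb R\times\mathbb R$ $$F_{\lambda,\mu}=(x-y)\frac{\partial^2}{\partial x\,\partial y}-\mu\frac{\partial}{\partial x}+\lambda\frac{\partial}{\partial y}.$$ Let $\mathrm{res}:C^\infty(\mathbb R\times\mathbb R)\to C^\infty(\mathbb R)$, $\mathrm{res}(f)(x)=f(x,x)$, and $B^{(k)}_{\lambda,\mu}=\mathrm{res}\circ F_{\lambda+k-1,\mu+k-1}\circ\dots\circ F_{\lambda+1,\mu+1}\circ F_{\lambda,\mu}$ (with $B^{(0)}_{\lambda,\mu}=\mathrm{res}$), the Rankin–Cohen brackets. $B^{(k)}_{\lambda,\mu}$ has constant coefficients, and its symbol $b^{(k)}_{\lambda,\mu}(\xi,\zeta)$ is the polynomial with $B^{(k)}_{\lambda,\mu}(e^{i(x\xi+y\zeta)})(x)=b^{(k)}_{\lambda,\mu}(\xi,\zeta)e^{i(x\xi+x\zeta)}$. For $\alpha,\beta\in\mathbb C$ and $l\in\mathbb N$, $q_l^{\alpha,\beta}(\xi,\eta)$ is the unique polynomial (homogeneous of degree $l$) such that, for $\xi,\eta>0$, $$\left(\frac{\partial}{\partial\xi}-\frac{\partial}{\partial\eta}\right)^l\big(\xi^{\alpha+l}\eta^{\beta+l}\big)=\xi^\alpha\eta^\beta\,q_l^{\alpha,\beta}(\xi,\eta).$$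 *)

(* Defs.v *)
From HB Require Import structures.
From mathcomp Require Import all_boot all_order all_algebra.
From mathcomp Require Import polyXY.
From mathcomp Require Import complex.
From mathcomp Require Import all_classical all_reals all_analysis.
Set Implicit Arguments.
Unset Strict Implicit.
Unset Printing Implicit Defensive.
Import Order.TTheory GRing.Theory Num.Theory.
Import numFieldNormedType.Exports.
Local Open Scope ring_scope.
Local Open Scope complex_scope.

Definition cexp (R : realType) (z : R[i]) : R[i] :=
  (expR (complex.Re z) * cos (complex.Im z)) +i*
  (expR (complex.Re z) * sin (complex.Im z)).

(* x ^ a, meaningful for 0 < x (principal determination) *)
Definition cpow (R : realType) (x : R) (a : R[i]) : R[i] :=
  cexp (a * (ln x)%:C).

(* R[i] carries no normed R-module structure in the library, hence the
   derivative of a complex-valued function of a real variable is taken on the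
   real and imaginary parts. *)
Definition cderive (R : realType) (g : R -> R[i]) (t : R) : R[i] :=
  derive1 (fun s => complex.Re (g s)) t +i*
  derive1 (fun s => complex.Im (g s)) t.

Definition partial1 (R : realType) (f : R -> R -> R[i]) : R -> R -> R[i] :=
  fun x y => cderive (fun s => f s y) x.

Definition partial2 (R : realType) (f : R -> R -> R[i]) : R -> R -> R[i] :=
  fun x y => cderive (fun s => f x s) y.

(* Derivatives being total functions in the library, the operators below are
   defined on all functions; they have their usual meaning on smooth ones, and
   are only applied to functions smooth near the points of evaluation. *)
Definition opF (R : realType) (lambda mu : R[i]) (f : R -> R -> R[i]) :
    R -> R -> R[i] :=
  fun x y => (x - y)%:C * partial1 (partial2 f) x y
             - mu * partial1 f x y + lambda * partial2 f x y.

Definition res (R : realType) (f : R -> R -> R[i]) : R -> R[i] :=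
  fun x => f x x.

Fixpoint iterF (R : realType) (lambda mu : R[i]) (k : nat)
    (f : R -> R -> R[i]) : R -> R -> R[i] :=
  if k is j.+1 then opF (lambda + j%:R) (mu + j%:R) (iterF lambda mu j f)
  else f.

Definition rankin_cohen (R : realType) (lambda mu : R[i]) (k : nat)
    (f : R -> R -> R[i]) : R -> R[i] :=
  res (iterF lambda mu k f).

(* Polynomials in two variables are elements b of {poly {poly R[i]}}; the value
   at (xi, zeta) is b.[xi, zeta] (see polyXY), the coefficient of
   xi ^ m * zeta ^ n is b`_m`_n. *)
Definition is_rc_symbol (R : realType) (lambda mu : R[i]) (k : nat)
    (b : {poly {poly R[i]}}) : Prop :=
  forall xi zeta x : R,
    rankin_cohen lambda mu k
      (fun x y => cexp ('i%C * (x * xi + y * zeta)%:C)) x =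
    b.[xi%:C, zeta%:C] * cexp ('i%C * (x * xi + x * zeta)%:C).

Definition homogeneous2 (R : realType) (l : nat) (q : {poly {poly R[i]}}) :
    Prop :=
  forall m n : nat, q`_m`_n != 0 -> (m + n)%N = l.

Definition opD (R : realType) (f : R -> R -> R[i]) : R -> R -> R[i] :=
  fun x y => partial1 f x y - partial2 f x y.

(* The values of cpow at nonpositive arguments are irrelevant: the derivatives
   are only evaluated in the open positive quadrant. *)
Definition is_q (R : realType) (alpha beta : R[i]) (l : nat)
    (q : {poly {poly R[i]}}) : Prop :=
  homogeneous2 l q /\
  forall xi eta : R, 0 < xi -> 0 < eta ->
    iter l (@opD R)
      (fun x y => cpow x (alpha + l%:R) * cpow y (beta + l%:R)) xi eta =
    cpow xi alpha * cpow eta beta * q.[xi%:C, eta%:C].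

(* Main.v *)
Require Import Defs.
From HB Require Import structures.
From mathcomp Require Import all_boot all_order all_algebra.
From mathcomp Require Import polyXY.
From mathcomp Require Import complex.
From mathcomp Require Import all_classical all_reals all_analysis.
From mathcomp Require Import ring.
Import GRing.Theory Num.Theory.
Import numFieldNormedType.Exports.
Local Open Scope ring_scope.
Local Open Scope complex_scope.

(** The key point is a duality in the exponential.  Write
    e(x,y) = exp(ax + by).  Multiplication by x - y acts on e as the vector
    field delta = d/da - d/db, so, with l = lambda and m = mu,
      F e = (ab delta + l b - m a) e = a^(1-l) b^(1-m) delta (a^l b^m e) =: L e.
    F acts in the variables x, y and L in the variables a, b, so the two
    commute, whatever their parameters, and
      F_(k-1) ... F_1 F_0 e = L_0 L_1 ... L_(k-1) e,
    where the index j stands for the parameters l + j, m + j.  The powers of a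
    and b telescope in the right-hand side, which is
      a^(1-l) b^(1-m) delta^k (a^(l+k-1) b^(m+k-1) e).
    On the diagonal x = y the exponential depends only on a + b, delta kills it
    and the factor of e that is left is the polynomial q_k with parameters
    l - 1, m - 1.  Finally a = i xi and b = i zeta.

    The commutation is proved in a polynomial ring.  All the functions that
    occur are p(x - y) e(x,y), with p a polynomial in t = x - y whose
    coefficients are polynomials in a and b.  Conjugation by e turns F and L
    into the operators [conjF] and [dualF] on such p, built from the commuting
    derivations d/dt and delta.  [conjF_dualF] is the commutation,
    [iter_conjFE] the exchange of the two products, and
    [iter_conjF_bracket_poly] its value at t = 0, a polynomial
    [bracket_poly] in a and b.  Calculus enters twice: [rankin_cohen_cexp]
    identifies [bracket_poly] with the symbol, and [iter_opD_cpow_poly]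
    identifies it with q_k.  Uniqueness holds because a polynomial that vanishes
    on the open positive quadrant is zero ([poly2_eq]). *)

(** * Derivations of a commutative ring *)

Section Derivations.
Set Implicit Arguments.
Unset Strict Implicit.

Definition derivation (A : comNzRingType) (d : A -> A) : Prop :=
  {morph d : x y / x + y} /\ forall x y, d (x * y) = d x * y + x * d y.

Section DerivationTheory.
Variables (A : comNzRingType) (d : A -> A).
Hypothesis dd : derivation d.

Lemma derivationD : {morph d : x y / x + y}. Proof. by case: dd. Qed.

Lemma derivationM x y : d (x * y) = d x * y + x * d y. Proof. by case: dd. Qed.

Lemma derivation0 : d 0 = 0.
Proof. by apply: (addIr (d 0)); rewrite -derivationD !add0r. Qed.

Lemma derivation1 : d 1 = 0.
Proof.
have := derivationM 1 1; rewrite !mulr1 mul1r => /eqP.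
by rewrite -subr_eq0 opprD addNKr oppr_eq0 => /eqP.
Qed.

Lemma derivationN : {morph d : x / - x}.
Proof.
by move=> x; apply: (addIr (d x)); rewrite -derivationD !addNr derivation0.
Qed.

Lemma derivationB : {morph d : x y / x - y}.
Proof. by move=> x y; rewrite derivationD derivationN. Qed.

Lemma derivationMn x n : d (x *+ n) = d x *+ n.
Proof.
by elim: n => [|n IH]; rewrite ?mulr0n ?derivation0 // !mulrS derivationD IH.
Qed.

Lemma coef_map_derivation p i : (map_poly d p)`_i = d p`_i.
Proof. by rewrite coef_map_id0 ?derivation0. Qed.

Lemma derivation_map_poly : derivation (map_poly d).
Proof.
split=> [p q|p q]; apply/polyP=> i.
  by rewrite coefD !coef_map_derivation coefD derivationD.
rewrite coefD !coefM coef_map_derivation coefM.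
rewrite (big_morph d derivationD derivation0) -big_split /=.
by apply: eq_bigr => j _; rewrite derivationM !coef_map_derivation.
Qed.

Lemma map_derivationC x : map_poly d x%:P = (d x)%:P.
Proof.
apply/polyP=> i; rewrite coef_map_derivation !coefC.
by case: eqP; rewrite ?derivation0.
Qed.

Lemma map_derivationX : map_poly d 'X = 0.
Proof.
apply/polyP=> i; rewrite coef_map_derivation coefX coef0.
by case: eqP; rewrite ?derivation0 ?derivation1.
Qed.

Lemma deriv_map_derivation p : (map_poly d p)^`() = map_poly d p^`().
Proof.
apply/polyP=> i.
by rewrite coef_deriv !coef_map_derivation coef_deriv derivationMn.
Qed.

End DerivationTheory.

Lemma derivation_deriv (A : comNzRingType) :
  derivation (@deriv A).
Proof. by split=> [p q|p q]; rewrite ?derivD ?derivM. Qed.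

Lemma derivation_sub (A : comNzRingType) (d e : A -> A) :
  derivation d -> derivation e -> derivation (fun x => d x - e x).
Proof.
move=> dd de; split=> x y.
  by rewrite (derivationD dd) (derivationD de); ring.
by rewrite (derivationM dd) (derivationM de); ring.
Qed.

End Derivations.

(** * The two commuting operators *)

Section Operators.
Set Implicit Arguments.
Unset Strict Implicit.
Implicit Type A : comNzRingType.

(** The conjugate of F by exp(ax + by), read on polynomials in t = x - y:
    there d/dx becomes D + a and d/dy becomes b - D, with D = d/dt. *)
Definition conjF A (D : A -> A) (t a b l m p : A) : A :=
  t * (D (b * p - D p) + a * (b * p - D p)) - m * (D p + a * p)
  + l * (b * p - D p).

(** The conjugate of L = ab delta + l b - m a by exp(ax + by): the vector
    field delta = d/da - d/db maps this exponential to t times itself. *)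
Definition dualF A (delta : A -> A) (t a b l m p : A) : A :=
  a * b * (delta p + t * p) + (l * b - m * a) * p.

(** The hypotheses say that D and delta act as d/dt and d/da - d/db.  Then both
    operators are conjugates, by the same exponential, of operators in disjoint
    sets of variables, hence the commutation for independent parameters. *)
Lemma conjF_dualF A (D delta : A -> A) (t a b l m l' m' p : A) :
    derivation D -> derivation delta -> (forall x, D (delta x) = delta (D x)) ->
    D t = 1 -> D a = 0 -> D b = 0 -> D l' = 0 -> D m' = 0 ->
    delta t = 0 -> delta a = 1 -> delta b = -1 -> delta l = 0 -> delta m = 0 ->
  conjF D t a b l m (dualF delta t a b l' m' p) =
  dualF delta t a b l' m' (conjF D t a b l m p).
Proof.
move=> dD dd Dd Dt Da Db Dl Dm dt da db dl dm; rewrite /conjF /dualF.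
do !rewrite ?(derivationD dD) ?(derivationD dd) ?(derivationN dD)
  ?(derivationN dd) ?(derivationM dD) ?(derivationM dd) ?Dt ?Da ?Db ?Dl ?Dm
  ?dt ?da ?db ?dl ?dm ?Dd ?(derivation0 dD) ?(derivation0 dd)
  ?(derivation1 dD) ?(derivation1 dd).
ring.
Qed.

Lemma rmorph_conjF A A' (phi : {rmorphism A -> A'}) (D : A -> A) (D' : A' -> A')
    (t a b l m p : A) :
  (forall x, phi (D x) = D' (phi x)) ->
  phi (conjF D t a b l m p) =
  conjF D' (phi t) (phi a) (phi b) (phi l) (phi m) (phi p).
Proof. by move=> H; rewrite /conjF !(rmorphD, rmorphN, rmorphM, H). Qed.

Lemma rmorph_dualF A A' (phi : {rmorphism A -> A'}) (d : A -> A) (d' : A' -> A')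
    (t a b l m p : A) :
  (forall x, phi (d x) = d' (phi x)) ->
  phi (dualF d t a b l m p) =
  dualF d' (phi t) (phi a) (phi b) (phi l) (phi m) (phi p).
Proof. by move=> H; rewrite /dualF !(rmorphD, rmorphN, rmorphM, H). Qed.

Fixpoint iter_conjF A (D : A -> A) (t a b l m : A) (k : nat) : A :=
  if k is j.+1
  then conjF D t a b (l + j%:R) (m + j%:R) (iter_conjF D t a b l m j)
  else 1.

(** The newest factor stands next to [p], opposite to [iter_conjF]: this is the
    order that results from moving each F past the factors L before it. *)
Fixpoint iter_dualF A (delta : A -> A) (t a b l m : A) (k : nat) (p : A) : A :=
  if k is j.+1
  then iter_dualF delta t a b l m j
         (dualF delta t a b (l + j%:R) (m + j%:R) p)
  else p.

Lemma derivation_addn A (D : A -> A) l j :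
  derivation D -> D l = 0 -> D (l + j%:R) = 0.
Proof.
move=> dD Dl.
by rewrite (derivationD dD) Dl add0r (derivationMn dD) (derivation1 dD) mul0rn.
Qed.

(** Both operators have the same value l b - m a + abt at the constant 1, since
    F e = L e.  So in F_k ... F_0 1 each F can be turned into an L when it meets
    the constant, after it has been moved past the factors L on its right. *)
Lemma iter_conjFE A (D delta : A -> A) (t a b l m : A) k :
    derivation D -> derivation delta -> (forall x, D (delta x) = delta (D x)) ->
    D t = 1 -> D a = 0 -> D b = 0 -> D l = 0 -> D m = 0 ->
    delta t = 0 -> delta a = 1 -> delta b = -1 -> delta l = 0 -> delta m = 0 ->
  iter_conjF D t a b l m k = iter_dualF delta t a b l m k 1.
Proof.
move=> dD dd Dd Dt Da Db Dl Dm dt da db dl dm.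
have conj_iter j n p :
    conjF D t a b (l + j%:R) (m + j%:R) (iter_dualF delta t a b l m n p) =
    iter_dualF delta t a b l m n (conjF D t a b (l + j%:R) (m + j%:R) p).
  elim: n p => //= n IH p; rewrite IH; congr iter_dualF.
  by apply: conjF_dualF => //; exact: derivation_addn.
elim: k => //= k ->; rewrite conj_iter; congr iter_dualF.
rewrite /conjF /dualF !(derivation1 dD) !(derivation1 dd) (derivationB dD).
rewrite (derivationM dD) Db (derivation1 dD) (derivation0 dD); ring.
Qed.

Lemma rmorph_iter_conjF A A' (phi : {rmorphism A -> A'}) (D : A -> A)
    (D' : A' -> A') (t a b l m : A) k :
  (forall x, phi (D x) = D' (phi x)) ->
  phi (iter_conjF D t a b l m k) =
  iter_conjF D' (phi t) (phi a) (phi b) (phi l) (phi m) k.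
Proof.
move=> H; elim: k => [|k IH] /=; first by rewrite rmorph1.
by rewrite (rmorph_conjF _ _ _ _ _ _ H) IH !rmorphD !rmorph_nat.
Qed.

Lemma rmorph_iter_dualF A A' (phi : {rmorphism A -> A'}) (d : A -> A)
    (d' : A' -> A') (t a b l m : A) k p :
  (forall x, phi (d x) = d' (phi x)) ->
  phi (iter_dualF d t a b l m k p) =
  iter_dualF d' (phi t) (phi a) (phi b) (phi l) (phi m) k (phi p).
Proof.
move=> H; elim: k p => //= k IH p.
by rewrite IH (rmorph_dualF _ _ _ _ _ _ H) !rmorphD !rmorph_nat.
Qed.

End Operators.

(** * Restriction to the diagonal *)

Section BivariatePolynomials.
Set Implicit Arguments.
Unset Strict Implicit.
Variable C : comNzRingType.
Implicit Types (p q : {poly {poly C}}) (a b l m : C).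

Definition delta_poly q : {poly {poly C}} := q^`() - map_poly (@deriv C) q.

Lemma derivation_delta_poly : derivation delta_poly.
Proof.
apply: derivation_sub; first exact: derivation_deriv.
exact: derivation_map_poly (derivation_deriv C).
Qed.

(** The variables 'X and 'X%:P stand for a and b; the argument 0 is the value
    of t on the diagonal. *)
Definition bracket_poly l m k : {poly {poly C}} :=
  iter_dualF delta_poly 0 'X 'X%:P l%:P%:P m%:P%:P k 1.

Definition ev2 a b : {poly {poly C}} -> C :=
  horner_eval b \o horner_eval a%:P.
HB.instance Definition _ a b := GRing.RMorphism.on (ev2 a b).

Lemma delta_polyC (c : C) : delta_poly c%:P%:P = 0.
Proof.
rewrite /delta_poly derivC (map_derivationC (derivation_deriv C)).
by rewrite derivC subr0.
Qed.

Lemma delta_polyX : delta_poly 'X = 1.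
Proof.
by rewrite /delta_poly derivX (map_derivationX (derivation_deriv C)) subr0.
Qed.

Lemma delta_polyY : delta_poly 'X%:P = -1.
Proof.
rewrite /delta_poly derivC (map_derivationC (derivation_deriv C)).
by rewrite derivX sub0r.
Qed.

Lemma ev2X a b : ev2 a b 'X = a.
Proof. by rewrite /ev2 /= /horner_eval hornerX hornerC. Qed.

Lemma ev2Y a b : ev2 a b 'X%:P = b.
Proof. by rewrite /ev2 /= /horner_eval hornerC hornerX. Qed.

Lemma ev2C a b c : ev2 a b c%:P%:P = c.
Proof. by rewrite /ev2 /= /horner_eval !hornerC. Qed.

(** Here the left-hand side lives over the numbers a and b, where delta has no
    meaning; the exchange of the operators takes place over the polynomials in a
    and b, before specialization. *)
Lemma iter_conjF_bracket_poly l m a b k :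
  (iter_conjF (@deriv C) 'X a%:P b%:P l%:P m%:P k).[0] =
  (bracket_poly l m k).[a, b].
Proof.
pose S : comNzRingType := {poly {poly {poly C}}}.
pose D : S -> S := @deriv _.
have dQ := derivation_delta_poly.
have dS := derivation_map_poly dQ.
pose P : S := iter_conjF D 'X 'X%:P 'X%:P%:P l%:P%:P%:P m%:P%:P%:P k.
have <- : map_poly (ev2 a b) P =
    iter_conjF (@deriv C) 'X a%:P b%:P l%:P m%:P k.
  rewrite /P (@rmorph_iter_conjF _ _ _ _ (@deriv C)); last first.
    by move=> x; rewrite deriv_map.
  by rewrite /= map_polyX !map_polyC /= ev2X ev2Y !ev2C.
(* Specialization of a and b commutes with evaluation at t = 0. *)
rewrite -[0 in LHS](rmorph0 (ev2 a b)) horner_map; congr (ev2 a b).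
have -> : P = iter_dualF (map_poly delta_poly) 'X 'X%:P 'X%:P%:P
                l%:P%:P%:P m%:P%:P%:P k 1.
  apply: iter_conjFE => //; rewrite /D.
  all: rewrite ?(map_derivationX, map_derivationC, derivC, derivX) //.
  - exact: derivation_deriv.
  - by move=> x; rewrite deriv_map_derivation.
  - by rewrite delta_polyX.
  - by rewrite delta_polyY rmorphN.
  - by rewrite delta_polyC.
  - by rewrite delta_polyC.
rewrite -/(horner_eval 0 _) (@rmorph_iter_dualF _ _ _ _ delta_poly); last first.
  by move=> x; rewrite /= /horner_eval !horner_coef0 coef_map_derivation.
rewrite /bracket_poly.
by congr iter_dualF; [exact: hornerX | exact: hornerC ..].
Qed.

End BivariatePolynomials.

(** * Derivatives of complex-valued functions of a real variable *)

Section ComplexDerivative.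
Set Implicit Arguments.
Unset Strict Implicit.
Variable R : realType.
Implicit Types (f g : R -> R[i]) (t : R) (c d e : R[i]).

Definition is_cderive t g d : Prop :=
  is_derive t (1 : R) (fun s => complex.Re (g s)) (complex.Re d) /\
  is_derive t (1 : R) (fun s => complex.Im (g s)) (complex.Im d).

Lemma cderive_val t g d : is_cderive t g d -> cderive g t = d.
Proof.
case: d => x y [/= hx hy]; rewrite /cderive !derive1E.
by rewrite !(@derive_val _ _ _ _ _ _ _ _).
Qed.

Lemma is_cderive_eq t g d e : is_cderive t g d -> d = e -> is_cderive t g e.
Proof. by move=> + <-. Qed.

Lemma near_eq_is_cderive t f g d :
  (\forall s \near t, f s = g s) -> is_cderive t f d -> is_cderive t g d.
Proof.
move=> fg [h1 h2]; split.
- by apply: near_eq_is_derive h1; apply: filterS fg => s ->.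
- by apply: near_eq_is_derive h2; apply: filterS fg => s ->.
Qed.

Lemma is_cderive_cst t c : is_cderive t (fun=> c) 0.
Proof. by split; exact: is_derive_cst. Qed.

Lemma is_cderive_real t (u : R -> R) (v : R) :
  is_derive t (1 : R) u v -> is_cderive t (fun s => (u s)%:C) v%:C.
Proof. by move=> h; split => //=; exact: is_derive_cst. Qed.

Lemma is_cderiveD t f g d e : is_cderive t f d -> is_cderive t g e ->
  is_cderive t (fun s => f s + g s) (d + e).
Proof.
move=> [f1 f2] [g1 g2]; split.
- rewrite raddfD /=.
  suff -> : (fun s => complex.Re (f s + g s)) =
    (fun s => complex.Re (f s)) \+ (fun s => complex.Re (g s)).
    exact: is_deriveD.
  by apply/funext => s /=; rewrite raddfD.
- rewrite raddfD /=.
  suff -> : (fun s => complex.Im (f s + g s)) =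
    (fun s => complex.Im (f s)) \+ (fun s => complex.Im (g s)).
    exact: is_deriveD.
  by apply/funext => s /=; rewrite raddfD.
Qed.

Lemma ReM c d : complex.Re (c * d) =
  complex.Re c * complex.Re d - complex.Im c * complex.Im d.
Proof. by case: c; case: d. Qed.

Lemma ImM c d : complex.Im (c * d) =
  complex.Re c * complex.Im d + complex.Im c * complex.Re d.
Proof. by case: c; case: d. Qed.

Lemma is_cderiveM t f g d e : is_cderive t f d -> is_cderive t g e ->
  is_cderive t (fun s => f s * g s) (d * g t + f t * e).
Proof.
move=> [f1 f2] [g1 g2]; split.
- rewrite raddfD /= !ReM.
  under eq_fun do rewrite ReM.
  apply: is_derive_eq (is_deriveB (is_deriveM f1 g1) (is_deriveM f2 g2)) _.
  rewrite /GRing.scale /=; ring.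
- rewrite raddfD /= !ImM.
  under eq_fun do rewrite ImM.
  apply: is_derive_eq (is_deriveD (is_deriveM f1 g2) (is_deriveM f2 g1)) _.
  rewrite /GRing.scale /=; ring.
Qed.

Lemma is_cderive_cexp t g d : is_cderive t g d ->
  is_cderive t (fun s => cexp (g s)) (d * cexp (g t)).
Proof.
move=> [g1 g2].
have E := is_derive1_comp (is_derive_expR (complex.Re (g t))) g1.
have C := is_derive1_comp (is_derive_cos (complex.Im (g t))) g2.
have S := is_derive1_comp (is_derive_sin (complex.Im (g t))) g2.
split.
- rewrite ReM /cexp /=.
  apply: is_derive_eq (is_deriveM E C) _.
  rewrite /GRing.scale /=; ring.
- rewrite ImM /cexp /=.
  apply: is_derive_eq (is_deriveM E S) _.
  rewrite /GRing.scale /=; ring.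
Qed.

Lemma is_cderive_horner t g d (p : {poly R[i]}) : is_cderive t g d ->
  is_cderive t (fun s => p.[g s]) (p^`().[g t] * d).
Proof.
move=> gd; elim/poly_ind: p => [|p c IH].
  rewrite deriv0 horner0 mul0r; under eq_fun do rewrite horner0.
  exact: is_cderive_cst.
under eq_fun do rewrite hornerMXaddC.
apply: is_cderive_eq (is_cderiveD (is_cderiveM IH gd) (is_cderive_cst _ _)) _.
by rewrite derivMXaddC hornerD hornerMX; ring.
Qed.

Lemma cexpD c d : cexp (c + d) = cexp c * cexp d.
Proof.
case: c => c1 c2; case: d => d1 d2; rewrite /cexp /= expRD cosD sinD.
by apply/eqP; rewrite eq_complex /=; apply/andP; split; apply/eqP; ring.
Qed.

Lemma cexp0 : cexp (0 : R[i]) = 1.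
Proof. by rewrite /cexp /= expR0 cos0 sin0 mulr0 mulr1. Qed.

Lemma cexp_neq0 c : cexp c != 0.
Proof.
apply/eqP => h; have : cexp (c + - c) = 0 by rewrite cexpD h mul0r.
by rewrite subrr cexp0 => /eqP; rewrite oner_eq0.
Qed.

Lemma cpowD (x : R) c d : cpow x (c + d) = cpow x c * cpow x d.
Proof. by rewrite /cpow mulrDl cexpD. Qed.

Lemma cpow1 (x : R) : 0 < x -> cpow x 1 = x%:C.
Proof.
by move=> x0; rewrite /cpow mul1r /cexp /= cos0 sin0 lnK ?mulr1 ?mulr0.
Qed.

Lemma cpow_neq0 (x : R) c : cpow x c != 0.
Proof. exact: cexp_neq0. Qed.

(** The exponent is c + 1 so that the derivative contains the power c, with no
    division by x. *)
Lemma is_cderive_cpow (x : R) c : 0 < x ->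
  is_cderive x (fun s => cpow s (c + 1)) ((c + 1) * cpow x c).
Proof.
move=> x0.
have := is_cderive_cexp (is_cderiveM (is_cderive_cst x (c + 1))
  (is_cderive_real (is_derive1_ln x0))).
move/is_cderive_eq; apply.
rewrite mul0r add0r -/(cpow x (c + 1)) cpowD cpow1 //.
have xu : x%:C != 0.
  by apply/eqP => /complexI /eqP; rewrite (negPf (lt0r_neq0 x0)).
by rewrite fmorphV -mulrA; congr *%R; rewrite mulrCA mulVf ?mulr1.
Qed.

End ComplexDerivative.

(** * Symbols and polynomials as values of differential operators *)

Section DifferentialOperators.
Set Implicit Arguments.
Unset Strict Implicit.
Variable R : realType.
Implicit Types (l m a b c : R[i]) (p : {poly R[i]}) (q : {poly {poly R[i]}}).

Definition polyexp a b p (x y : R) : R[i] :=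
  p.[(x - y)%:C] * cexp (a * x%:C + b * y%:C).

Lemma partial1_polyexp a b p :
  partial1 (polyexp a b p) = polyexp a b (p^`() + a%:P * p).
Proof.
apply/funext => x; apply/funext => y; apply: cderive_val.
have d1 : is_cderive x (fun s => (s - y)%:C) 1.
  apply: is_cderive_real; apply: is_derive_eq (is_deriveB _ _) _.
  by rewrite subr0.
have d2 : is_cderive x (fun s => a * s%:C + b * y%:C) a.
  apply: is_cderive_eq (is_cderiveD (is_cderiveM (is_cderive_cst _ _)
    (is_cderive_real (is_derive_id _ _))) (is_cderive_cst _ _)) _.
  by rewrite mul0r add0r addr0 mulr1.
apply: is_cderive_eq (is_cderiveM (is_cderive_horner p d1)
  (is_cderive_cexp d2)) _.
by rewrite /polyexp hornerD hornerM hornerC; ring.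
Qed.

Lemma partial2_polyexp a b p :
  partial2 (polyexp a b p) = polyexp a b (b%:P * p - p^`()).
Proof.
apply/funext => x; apply/funext => y; apply: cderive_val.
have d1 : is_cderive y (fun s => (x - s)%:C) (-1).
  have -> : -1 = (-1)%:C :> R[i] by rewrite rmorphN1.
  apply: is_cderive_real; apply: is_derive_eq (is_deriveB _ _) _.
  by rewrite sub0r.
have d2 : is_cderive y (fun s => a * x%:C + b * s%:C) b.
  apply: is_cderive_eq (is_cderiveD (is_cderive_cst _ _) (is_cderiveM
    (is_cderive_cst _ _) (is_cderive_real (is_derive_id _ _)))) _.
  by rewrite mul0r !add0r mulr1.
apply: is_cderive_eq (is_cderiveM (is_cderive_horner p d1)
  (is_cderive_cexp d2)) _.
by rewrite /polyexp hornerD hornerN hornerM hornerC; ring.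
Qed.

Lemma opF_polyexp l m a b p :
  opF l m (polyexp a b p) =
  polyexp a b (conjF (@deriv R[i]) 'X a%:P b%:P l%:P m%:P p).
Proof.
apply/funext => x; apply/funext => y.
rewrite /opF partial2_polyexp !partial1_polyexp /polyexp /conjF.
rewrite !(hornerD, hornerN, hornerM, hornerC, hornerX); ring.
Qed.

Lemma iterF_polyexp l m a b k :
  iterF l m k (polyexp a b 1) =
  polyexp a b (iter_conjF (@deriv R[i]) 'X a%:P b%:P l%:P m%:P k).
Proof.
by elim: k => //= k ->; rewrite opF_polyexp !polyCD !polyC_natr.
Qed.

Lemma rankin_cohen_cexp l m k (xi zeta x : R) :
  rankin_cohen l m k (fun x y => cexp ('i%C * (x * xi + y * zeta)%:C)) x =
  (bracket_poly l m k).['i%C * xi%:C, 'i%C * zeta%:C] *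
  cexp ('i%C * (x * xi + x * zeta)%:C).
Proof.
have expE u v : 'i%C * (u * xi + v * zeta)%:C =
    'i%C * xi%:C * u%:C + 'i%C * zeta%:C * v%:C :> R[i].
  by rewrite rmorphD !rmorphM; ring.
have -> : (fun x y => cexp ('i%C * (x * xi + y * zeta)%:C)) =
    polyexp ('i%C * xi%:C) ('i%C * zeta%:C) 1.
  by apply/funext => u; apply/funext => v; rewrite /polyexp hornerC mul1r expE.
rewrite /rankin_cohen iterF_polyexp /res /polyexp subrr.
by rewrite iter_conjF_bracket_poly expE.
Qed.

Definition cpow_poly l m q (x y : R) : R[i] :=
  cpow x l * cpow y m * q.[x%:C, y%:C].

Lemma is_cderive_horner2l q (x y : R) :
  is_cderive x (fun s => q.[s%:C, y%:C]) q^`().[x%:C, y%:C].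
Proof.
have E r s : r.[s%:C, y%:C] = (map_poly (horner_eval y%:C) r).[s%:C].
  by rewrite -{2}[s%:C](hornerC _ y%:C) -/(horner_eval y%:C _%:P) horner_map.
rewrite E -deriv_map; under eq_fun do rewrite E.
apply: is_cderive_eq
  (is_cderive_horner _ (is_cderive_real (is_derive_id _ _))) _.
by rewrite mulr1.
Qed.

Lemma is_cderive_horner2r q (x y : R) :
  is_cderive y (fun s => q.[x%:C, s%:C])
    (map_poly (@deriv R[i]) q).[x%:C, y%:C].
Proof.
apply: is_cderive_eq
  (is_cderive_horner _ (is_cderive_real (is_derive_id _ _))) _.
rewrite mulr1; congr _.[_].
elim/poly_ind: q => [|q c IH]; first by rewrite map_poly0 !horner0 linear0.
have D := derivation_map_poly (derivation_deriv R[i]).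
rewrite hornerMXaddC (derivationD D) (derivationM D).
rewrite (map_derivationX (derivation_deriv _)).
rewrite (map_derivationC (derivation_deriv _)) mulr0 addr0 hornerMXaddC -IH.
by rewrite derivD derivM derivC mulr0 addr0.
Qed.

(** One step of the telescoping: L is the conjugate of delta by powers, up to
    the factor ab that lowers both exponents by one. *)
Lemma opD_cpow_poly l m q (f : R -> R -> R[i]) :
  (forall x y : R, 0 < x -> 0 < y -> f x y = cpow_poly (l + 1) (m + 1) q x y) ->
  forall x y : R, 0 < x -> 0 < y -> opD f x y =
    cpow_poly l m (dualF (@delta_poly R[i]) 0 'X 'X%:P (l + 1)%:P%:P
                     (m + 1)%:P%:P q) x y.
Proof.
move=> fE x y x0 y0; rewrite /opD.
have -> : partial1 f x y = (l + 1) * cpow x l * cpow y (m + 1) * q.[x%:C, y%:C]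
    + cpow x (l + 1) * cpow y (m + 1) * q^`().[x%:C, y%:C].
  apply: cderive_val.
  apply: (@near_eq_is_cderive _ _ (fun s => cpow_poly (l + 1) (m + 1) q s y)).
    by near=> s; rewrite fE //; near: s; exact: lt_nbhsr.
  apply: is_cderive_eq (is_cderiveM (is_cderiveM (is_cderive_cpow l x0)
    (is_cderive_cst _ _)) (is_cderive_horner2l q x y)) _.
  by rewrite mulr0 addr0.
have -> : partial2 f x y = cpow x (l + 1) * ((m + 1) * cpow y m) *
      q.[x%:C, y%:C]
    + cpow x (l + 1) * cpow y (m + 1) * (map_poly (@deriv R[i]) q).[x%:C, y%:C].
  apply: cderive_val.
  apply: (@near_eq_is_cderive _ _ (fun s => cpow_poly (l + 1) (m + 1) q x s)).
    by near=> s; rewrite fE //; near: s; exact: lt_nbhsr.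
  apply: is_cderive_eq (is_cderiveM (is_cderiveM (is_cderive_cst _ _)
    (is_cderive_cpow m y0)) (is_cderive_horner2r q x y)) _.
  by rewrite mul0r add0r.
rewrite !cpowD !cpow1 // /cpow_poly /dualF /delta_poly.
rewrite !(hornerD, hornerN, hornerM, hornerC, hornerX); ring.
Unshelve. all: by end_near. Qed.

(** Each derivative is taken of a function known on the open quadrant only, a
    neighbourhood of the points considered; hence the hypothesis on [f] instead
    of an explicit function. *)
Lemma iter_opD_cpow_poly l m k q (f : R -> R -> R[i]) :
  (forall x y : R, 0 < x -> 0 < y ->
     f x y = cpow_poly (l - 1 + k%:R) (m - 1 + k%:R) q x y) ->
  forall x y : R, 0 < x -> 0 < y -> iter k (@opD R) f x y =
    cpow_poly (l - 1) (m - 1) (iter_dualF (@delta_poly R[i]) 0 'X 'X%:P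
      l%:P%:P m%:P%:P k q) x y.
Proof.
elim: k q f => [|k IH] q f fE x y x0 y0.
  by rewrite /= fE // !addr0.
rewrite iterSr /=; apply: IH => // {x y x0 y0}x y x0 y0.
have S c : c - 1 + k%:R + 1 = c + k%:R by ring.
rewrite (@opD_cpow_poly (l - 1 + k%:R) (m - 1 + k%:R) q) //.
  by rewrite !S !polyCD !polyC_natr.
by move=> u v u0 v0; rewrite fE // -!addrA -!natr1.
Qed.

End DifferentialOperators.

(** * Homogeneity *)

Section Homogeneity.
Set Implicit Arguments.
Unset Strict Implicit.
Variable R : realType.
Implicit Types (p q : {poly {poly R[i]}}).

Lemma homogeneous2P k q :
  homogeneous2 k q <-> forall m n, (m + n)%N <> k -> q`_m`_n = 0.
Proof.
split=> [h m n mn | h m n]; last by apply: contra_neq_eq => /eqP /h.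
by apply/eqP/negPn/negP => /h.
Qed.

Lemma homogeneous2C (c : R[i]) : homogeneous2 0 c%:P%:P.
Proof. by apply/homogeneous2P => -[|i] [|j] // _; rewrite !coefC //= coef0. Qed.

Lemma homogeneous2D k p q :
  homogeneous2 k p -> homogeneous2 k q -> homogeneous2 k (p + q).
Proof.
by rewrite !homogeneous2P => hp hq m n mn; rewrite !coefD hp // hq // addr0.
Qed.

Lemma homogeneous2Z k c q : homogeneous2 k q -> homogeneous2 k (c%:P%:P * q).
Proof. by rewrite !homogeneous2P => h m n mn; rewrite !coefCM h // mulr0. Qed.

Lemma homogeneous2N k q : homogeneous2 k q -> homogeneous2 k (- q).
Proof. by rewrite !homogeneous2P => h m n mn; rewrite !coefN h // oppr0. Qed.

Lemma homogeneous2X k q : homogeneous2 k q -> homogeneous2 k.+1 ('X * q).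
Proof.
rewrite !homogeneous2P => h [|m] n mn; rewrite coefXM /= ?coef0 // h //.
by move=> mnk; apply: mn; rewrite addSn mnk.
Qed.

Lemma homogeneous2Y k q : homogeneous2 k q -> homogeneous2 k.+1 ('X%:P * q).
Proof.
rewrite !homogeneous2P => h m [|n] mn; rewrite coefCM coefXM //= h //.
by move=> mnk; apply: mn; rewrite addnS mnk.
Qed.

(** A derivative alone would lower the degree, which truncates at degree 0; the
    Euler operators keep it. *)
Lemma homogeneous2_eulerX k q : homogeneous2 k q -> homogeneous2 k ('X * q^`()).
Proof.
rewrite !homogeneous2P => h [|m] n mn; rewrite coefXM /= ?coef0 //.
by rewrite coef_deriv coefMn h // mul0rn.
Qed.

Lemma homogeneous2_eulerY k q :
  homogeneous2 k q -> homogeneous2 k ('X%:P * map_poly (@deriv R[i]) q).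
Proof.
rewrite !homogeneous2P => h m [|n] mn; rewrite coefCM coefXM //=.
by rewrite (coef_map_derivation (derivation_deriv _)) coef_deriv h // mul0rn.
Qed.

Lemma homogeneous2_dualF k (l m : R[i]) q : homogeneous2 k q ->
  homogeneous2 k.+1 (dualF (@delta_poly R[i]) 0 'X 'X%:P l%:P%:P m%:P%:P q).
Proof.
move=> h.
(* The factor ab of delta splits into Euler operators and one variable. *)
have -> : dualF (@delta_poly R[i]) 0 'X 'X%:P l%:P%:P m%:P%:P q =
    'X%:P * ('X * q^`()) + - ('X * ('X%:P * map_poly (@deriv R[i]) q)) +
    (l%:P%:P * ('X%:P * q) + - (m%:P%:P * ('X * q))).
  by rewrite /dualF /delta_poly; ring.
apply: homogeneous2D; apply: homogeneous2D; try apply: homogeneous2N.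
- exact/homogeneous2Y/homogeneous2_eulerX.
- exact/homogeneous2X/homogeneous2_eulerY.
- exact/homogeneous2Z/homogeneous2Y.
- exact/homogeneous2Z/homogeneous2X.
Qed.

Lemma homogeneous2_bracket_poly (l m : R[i]) k :
  homogeneous2 k (bracket_poly l m k).
Proof.
rewrite /bracket_poly -[in homogeneous2 k](addn0 k).
have := @homogeneous2C 1; rewrite !polyC1.
elim: k 0%N 1 => //= k IH j q hq.
rewrite addSnnS; apply: IH; rewrite -!polyC_natr -!polyCD.
exact: homogeneous2_dualF.
Qed.

Lemma horner2_homogeneous k q (c x y : R[i]) : homogeneous2 k q ->
  q.[c * x, c * y] = c ^+ k * q.[x, y].
Proof.
move=> h.
have E u v : q.[u, v] =
    \sum_(i < size q) \sum_(j < size q`_i) q`_i`_j * u ^+ i * v ^+ j.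
  rewrite (horner_coef q) horner_sum; apply: eq_bigr => i _.
  rewrite hornerM -polyC_exp hornerC horner_coef mulr_suml.
  by apply: eq_bigr => j _; rewrite mulrAC.
rewrite !E mulr_sumr; apply: eq_bigr => i _; rewrite mulr_sumr.
apply: eq_bigr => j _; have [->|/h <-] := eqVneq q`_i`_j 0.
  by rewrite !mul0r mulr0.
by rewrite !exprMn exprD; ring.
Qed.

End Homogeneity.

(** * Uniqueness *)

Section Uniqueness.
Set Implicit Arguments.
Unset Strict Implicit.

Lemma poly_eq0_nat (A : idomainType) (f : nat -> A) (p : {poly A}) :
  injective f -> (forall n, p.[f n] = 0) -> p = 0.
Proof.
move=> fI p0; apply/eqP/negPn/negP => pn0.
have roots : all (root p) (map f (iota 0 (size p))).
  by apply/allP => _ /mapP[n _ ->]; apply/rootP.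
have := max_poly_roots pn0 roots.
by rewrite map_inj_uniq // iota_uniq size_map size_iota ltnn => /(_ isT).
Qed.

Lemma poly2_eq (R : realType) (p q : {poly {poly R[i]}}) :
  (forall x y : R, 0 < x -> 0 < y -> p.[x%:C, y%:C] = q.[x%:C, y%:C]) -> p = q.
Proof.
move=> pq; apply/eqP; rewrite -subr_eq0; apply/eqP.
pose f n : R[i] := n.+1%:R%:C.
have fI : injective f.
  by move=> i j /complexI /eqP; rewrite eqr_nat => /eqP[].
apply: (@poly_eq0_nat _ (fun n => (f n)%:P)) => [i j /polyC_inj/fI //|i].
apply: (@poly_eq0_nat _ f) => // j.
by rewrite !hornerD !hornerN pq ?subrr // ltr0Sn.
Qed.

End Uniqueness.

(** * The symbol of the Rankin-Cohen brackets *)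

Theorem theorem5p1 (R : realType) (lambda mu : R[i]) (k : nat) :
  exists b q : {poly {poly R[i]}},
    [/\ unique (is_rc_symbol lambda mu k) b,
        unique (is_q (lambda - 1) (mu - 1) k) q
      & forall xi zeta : R[i],
          b.[xi, zeta] = q.['i%C * xi, 'i%C * zeta] /\
          q.['i%C * xi, 'i%C * zeta] = 'i%C ^+ k * q.[xi, zeta]].
Proof.
pose q := bracket_poly lambda mu k.
pose b : {poly {poly R[i]}} := ('i%C ^+ k)%:P%:P * q.
have qi xi zeta : q.['i%C * xi, 'i%C * zeta] = 'i%C ^+ k * q.[xi, zeta].
  exact/horner2_homogeneous/homogeneous2_bracket_poly.
have bE xi zeta : b.[xi, zeta] = q.['i%C * xi, 'i%C * zeta].
  by rewrite qi /b !(hornerM, hornerC).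
have b_symbol : is_rc_symbol lambda mu k b.
  by move=> xi zeta x; rewrite bE rankin_cohen_cexp.
have q_is_q : is_q (lambda - 1) (mu - 1) k q.
  split=> [|x y x0 y0]; first exact: homogeneous2_bracket_poly.
  apply: (@iter_opD_cpow_poly R lambda mu k 1) => // u v _ _.
  by rewrite /cpow_poly !hornerC mulr1.
exists b, q; split=> //.
- split=> // b' b'_symbol; apply: poly2_eq => x y _ _.
  apply: (mulIf (cexp_neq0 ('i%C * (0 * x + 0 * y)%:C))).
  by rewrite -b_symbol -b'_symbol.
- split=> // q' [_ q'E]; apply: poly2_eq => x y x0 y0.
  apply: (mulfI (mulf_neq0 (cpow_neq0 x (lambda - 1)) (cpow_neq0 y (mu - 1)))).
  by rewrite -q'E // -(q_is_q.2 _ _ x0 y0).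
Qed.
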